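(* Let $d,n$ be positive integers such that $d$ divides $n$, i.e. $n=k\cdot d$ for some positive integer $k$. Suppose that $X$ is a random variable that can be written in the form $$X=\sum_{(i_1,\ldots,i_d)\in[n]^d_{<}}F(\xi_{i_1},\ldots,\xi_{i_d}),$$ where $\xi_1,\ldots,\xi_n$ are independent and identically distributed random variables and $F:\mathbb{R}^d\to[0,1]$ is a bounded function. Set $p:=\mathbb{E}[F(\xi_{i_1},\ldots,\xi_{i_d})]$, $N_d:=\binom{n-1}{d-1}$, and let $\mathcal{F}$ be the set of all functions $f:\mathbb{R}\to[0,+\infty)$ that are increasing and convex. If $y=\mathbb{E}[X]+t\binom nd$ for some $t\in(0,1-p)$, then $$\mathbb{P}[X\ge y]\le\inf_{f\in\mathcal{F}}\frac{1}{f(y)}\,\mathbb{E}\left[f(N_d\cdot B_{k,p})\right],$$ where $B_{k,p}$ is a binomial $\mathrm{Bin}(k,p)$ random variable. Moreover, if $t$ belongs to the interval $\left(\frac{p(1-p)(e-1)}{1-p+ep},1-p\right)$ and $k(p+t)$ is a positive integer from the interval $(kp,k)$, then $$\inf_{f\in\mathcal{F}}\frac{1}{f(y)}\,\mathbb{E}\left[f(N_d\cdot B_{k,p})\right]\le\frac{hN_d+1}{e^{hN_d}}\left(\exp(-2kt^2)-T_2(k,p,t)\right)+\left(1-\frac{hN_d+1}{e^{hN_d}}\right)\mathbb{P}[B_{k,p}=k(p+t)],$$ where $$T_2(k,p,t):=\sum_{j=0}^{k(p+t)-1}e^{h(N_dj-y)}\,\mathbb{P}[B_{k,p}=j]$$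 and $h$ is the positive real satisfying $$e^{-hy}\,\mathbb{E}\left[e^{hN_dB_{k,p}}\right]=\inf_{s>0}e^{-sy}\,\mathbb{E}\left[e^{sN_dB_{k,p}}\right].$$ The right-hand side of the latter bound is strictly less than $\exp(-2kt^2)$.
   Context: $[n]=\{1,\ldots,n\}$ and $[n]^d_{<}=\{(i_1,\ldots,i_d)\in[n]^d:1\le i_1<i_2<\cdots<i_d\le n\}$. The function $F$ is measurable; $p$ does not depend on the choice of $(i_1,\ldots,i_d)$ since the $\xi_i$ are i.i.d. ''Increasing'' means non-decreasing. In the infimum over $f\in\mathcal{F}$, only functions with $f(y)>0$ are considered. *)

(* Defs.v *)
From HB Require Import structures.
From mathcomp Require Export all_boot all_order all_algebra.
From mathcomp Require Export all_classical all_reals all_analysis.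

Set Implicit Arguments.
Unset Strict Implicit.
Unset Printing Implicit Defensive.

Import Order.TTheory GRing.Theory Num.Theory.
Import numFieldNormedType.Exports.

Local Open Scope classical_set_scope.
Local Open Scope ring_scope.

(* $[n]^d_<$, with indices counted from 0 *)
Definition strictly_increasing (n d : nat) (i : d.-tuple 'I_n) : bool :=
  sorted ltn [seq val j | j <- i].

Section random_variables.
Context {disp disp' : measure_display} {T : measurableType disp}
  {T' : measurableType disp'} {R : realType} (P : probability T R).
Local Open Scope ereal_scope.

Definition mutually_independent (I : finType) (xi : I -> {RV P >-> T'}) : Prop :=
  forall (J : {set I}) (A : I -> set T'), (forall i, measurable (A i)) ->
    P (\bigcap_(i in [set` J]) (xi i @^-1` A i)) =
    \prod_(i in J) P (xi i @^-1` A i).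

(* The laws are compared on measurable sets only: the value of
   [distribution P X] on a non-measurable set carries no meaning. *)
Definition identically_distributed (I : Type) (xi : I -> {RV P >-> T'}) : Prop :=
  forall (i j : I) (A : set T'), measurable A ->
    distribution P (xi i) A = distribution P (xi j) A.

End random_variables.

Definition increasing_convex (R : realType) : set (R -> R) :=
  [set f | [/\ forall x, 0 <= f x,
               nondecreasing_fun f &
               convex_function [set: R^o] (f : R^o -> R^o)]].

Section bounds.
Context {disp : measure_display} {T : measurableType disp} {R : realType}
  (P : probability T R) (B : {RV P >-> nat}).
Local Open Scope ereal_scope.

Definition increasing_convex_bound (N : nat) (y : R) : \bar R :=
  ereal_inf [set ((f y)^-1)%:E * 'E_P[fun w => f (N%:R * (B w)%:R)%R]
            | f in [set f | increasing_convex f /\ (0 < f y)%R]].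

Definition exponential_bound (N : nat) (y s : R) : \bar R :=
  (expR (- (s * y)))%:E * 'E_P[fun w => expR (s * N%:R * (B w)%:R)].

(* [m] stands for the integer $k(p+t)$. *)
Definition T2 (N : nat) (h y : R) (m : nat) : \bar R :=
  \sum_(0 <= j < m)
    (expR (h * (N%:R * j%:R - y)))%:E * P [set w | B w = j].

Definition refined_bound (N : nat) (h y : R) (k m : nat) (t : R) : \bar R :=
  let c : R := ((h * N%:R + 1) / expR (h * N%:R))%R in
  c%:E * ((expR (- (2 * k%:R * t ^+ 2)))%:E - T2 N h y m) +
  (1 - c)%:E * P [set w | B w = m].

End bounds.

(* Main.v *)
From HB Require Import structures.
Require Import Defs.
From mathcomp Require Import fingroup perm measurable_realfun ring lra.
Import Order.TTheory GRing.Theory Num.Theory.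
Import numFieldNormedType.Exports.

(** The sum X is an average of sums of k independent terms. Cut [n] into k
    blocks of d consecutive indices. For a permutation s of [n] let S_s be
    the sum, over the k images of the blocks under s, of F evaluated at the
    variables indexed by the image listed in increasing order. The images are
    disjoint, so S_s is a sum of k independent [0,1]-valued variables of mean
    p, and each d-subset of [n] is the image of a given block under the same
    number of permutations; as 'C(n, d) = k * N, X is the mean of N * S_s
    over s ([sum_strictly_increasing_avg]).

    For f convex, Jensen gives f X <= mean of f (N * S_s). On [0,1]^k the
    function x |-> f (N * (x_1 + ... + x_k)) lies below its multilinear
    interpolation from the vertices of the cube
    ([convex_bernoulli_weight]). Independence of the blocks makes the
    expectation of this interpolation explicit: it is
    E[f (N * Bin(k, p))]. The first bound is then Markov's inequality
    ([convex_tail_bound]). Interpolating before integrating leaves only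
    products of the bounded variables F(...) and 1 - F(...) to integrate.

    Independence of the blocks is obtained from that of the coordinates: two
    finite measures on tuples that agree on boxes are equal, so a joint law
    that factorizes on boxes is a product measure, and Fubini turns it into a
    factorization of expectations ([integral_prod_blocks]).

    For the second bound write a = p + t, so that y = m * N with m = k * a,
    and put x = h * N. The minimizer x of exp (- x m) (1 - p + p exp x)^k is
    the logarithm of a (1 - p) / (p (1 - a)), and the lower bound on t says
    exactly that this ratio exceeds e, so that 1 < x ([minimizer_gt1]). Take for f the hinge z |-> max(0, 1 + h (z - y)).
    Because 1 < x it vanishes at N j for j < m; it is 1 for j = m; and for
    j > m it is at most c exp (x (j - m)), where c = (x + 1) / exp x < 1,
    because (1 + u) / exp u decreases. Summing against the binomial weights
    gives the bound with E[exp (h (N * B - y))] in place of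
    exp (- 2 k t^2), and the former is at most the latter by the minimality
    of h and Hoeffding's lemma, applied at the exponent 4 t / N
    ([chernoff_hoeffding]). The bound is strictly below exp (- 2 k t^2) since
    P[B = m] is at most exp (- 2 k t^2), c < 1 and T2 > 0. *)

Set Implicit Arguments.
Unset Strict Implicit.
Unset Printing Implicit Defensive.

Local Open Scope classical_set_scope.
Local Open Scope ring_scope.

(** * Measures on tuples *)

Section tuple_laws.
Context {d} {T : measurableType d} {R : realType} (m : nat).
Local Open Scope ereal_scope.

Definition box (A : 'I_m -> set T) : set (m.-tuple T) :=
  [set x | forall i, A i (tnth x i)].

Definition boxes : set (set (m.-tuple T)) :=
  [set box A | A in [set A | forall i, measurable (A i)]].

Lemma measurable_box (A : 'I_m -> set T) :
  (forall i, measurable (A i)) -> measurable (box A).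
Proof.
move=> mA; rewrite (_ : box A =
  \big[setI/setT]_(i < m) ((fun x : m.-tuple T => tnth x i) @^-1` A i)).
  apply: bigsetI_measurable => i _.
  by rewrite -[X in measurable X]setTI; exact: measurable_tnth.
by apply/seteqP; rewrite -bigcap_seq; split=> x /= h i;
  [move=> _; exact: h|exact: h (mem_index_enum i)].
Qed.

Lemma measurable_boxesE : @measurable _ (m.-tuple T) = <<s boxes >>.
Proof.
apply/seteqP; split; last first.
  apply: smallest_sub; first exact: sigma_algebra_measurable.
  by move=> _ [A mA <-]; exact: measurable_box.
apply: smallest_sub; first exact: smallest_sigma_algebra.
rewrite -bigcup_seq => B [i _ [C mC <-]]; apply: sub_sigma_algebra.
exists (fun j => if j == i then C else setT).
  by move=> j /=; case: ifP.
rewrite setTI; apply/seteqP; split=> x /=; first by move/(_ i); rewrite eqxx.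
by move=> Cx j; case: eqP => // ->.
Qed.

(** Boxes form a pi-system that generates the sigma-algebra of tuples and
    contains the whole space, which is what the uniqueness theorem for finite
    measures asks for. *)
Lemma tuple_measure_unique (m1 m2 : {measure set (m.-tuple T) -> \bar R}) :
  m1 setT < +oo ->
  (forall A : 'I_m -> set T, (forall i, measurable (A i)) ->
    m1 (box A) = m2 (box A)) ->
  forall C, measurable C -> m1 C = m2 C.
Proof.
move=> m1oo m12 C mC.
apply: (measure_unique boxes (fun=> setT)) => //.
- exact: measurable_boxesE.
- move=> _ _ [A mA <-] [A' mA' <-]; exists (fun i => A i `&` A' i).
    by move=> i; apply: measurableI.
  by apply/seteqP; split=> x /= h; [split=> i; have [] := h i|case: h => h h' i; split].
- by move=> _; exists (fun=> setT) => //; apply/seteqP; split=> x.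
- by rewrite bigcup_const//; exists 0%N.
- by move=> _ [A mA <-]; exact: m12.
Qed.

End tuple_laws.

(** * Blocks of independent coordinates *)

Section independent_coordinates.
Context {disp disp' : measure_display} {T : measurableType disp}
  {T' : measurableType disp'} {R : realType} (P : probability T R) (n : nat).
Variable xi : 'I_n -> {RV P >-> T'}.
Local Open Scope ereal_scope.

Definition subfamily m (e : m.-tuple 'I_n) (w : T) : m.-tuple T' :=
  [tuple xi (tnth e a) w | a < m].

Lemma measurable_subfamily m (e : m.-tuple 'I_n) :
  measurable_fun [set: T] (subfamily e).
Proof.
apply/measurable_fun_tnthP => a.
rewrite (_ : _ \o _ = xi (tnth e a))//.
by apply/funext => w /=; rewrite tnth_mktuple.
Qed.

HB.instance Definition _ m (e : m.-tuple 'I_n) :=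
  isMeasurableFun.Build _ _ _ _ (subfamily e) (measurable_subfamily e).

Hypothesis xi_indep : mutually_independent xi.

(** Mutual independence is stated for families of events indexed by all of
    'I_n; the events of a box are placed at the entries of e, which is
    unambiguous because these entries are distinct. *)
Lemma subfamily_box m (e : m.-tuple 'I_n) (A : 'I_m -> set T') :
    uniq e -> (forall a, measurable (A a)) ->
  P (subfamily e @^-1` box A) = \prod_(a < m) P (xi (tnth e a) @^-1` A a).
Proof.
move=> /tuple_uniqP e_inj mA.
pose A' i := if [pick a | tnth e a == i] is Some a then A a else setT.
have A'E a : A' (tnth e a) = A a.
  rewrite /A'; case: pickP => [b /eqP /e_inj ->//|/(_ a)].
  by rewrite eqxx.
have mA' i : measurable (A' i) by rewrite /A'; case: pickP.
have := xi_indep [set tnth e a | a : 'I_m] mA'.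
rewrite big_imset/=; last by move=> a b _ _ /e_inj.
under eq_bigr do rewrite A'E.
move=> <-; congr (P _); apply/seteqP; split=> w /=.
  move=> h i /= /imsetP[a _ ->]; rewrite A'E.
  by have := h a; rewrite tnth_mktuple.
by move=> h a; rewrite tnth_mktuple -A'E; apply: h; apply/imsetP; exists a.
Qed.

Lemma subfamily_ident m (e e' : m.-tuple 'I_n) :
    identically_distributed xi -> uniq e -> uniq e' ->
  forall C, measurable C ->
    distribution P (subfamily e) C = distribution P (subfamily e') C.
Proof.
move=> xi_ident ue ue' C mC; apply: tuple_measure_unique => //.
  by rewrite /= /distribution /pushforward preimage_setT probability_setT ltry.
move=> A mA; rewrite [LHS]subfamily_box// [RHS]subfamily_box//.
by apply: eq_bigr => a _; exact: xi_ident.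
Qed.

(** Independence from a fixed event E extends from boxes to all measurable
    sets: both sides are finite measures in C. *)
Lemma subfamily_indep_event m (e : m.-tuple 'I_n) (E : set T) :
    measurable E ->
    (forall A, (forall a, measurable (A a)) ->
      P (subfamily e @^-1` box A `&` E) = P (subfamily e @^-1` box A) * P E) ->
  forall C, measurable C ->
    P (subfamily e @^-1` C `&` E) = P (subfamily e @^-1` C) * P E.
Proof.
move=> mE PE C mC.
have PEfin : P E \is a fin_num by exact: fin_num_measure.
pose c := NngNum (fine_ge0 (measure_ge0 P E)).
pose m1 := pushforward (mrestr P mE) (subfamily e).
pose m2 := mscale c (distribution P (subfamily e)).
have m2E D : P (subfamily e @^-1` D) * P E = m2 D.
  by rewrite /m2 /mscale /= fineK// muleC.
rewrite m2E.
apply: (@tuple_measure_unique _ _ _ _ m1 m2) => //.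
  by change (P (setT `&` E) < +oo); rewrite setTI ltey_eq PEfin.
by move=> A mA; exact: etrans (PE A mA) (m2E _).
Qed.

(** The extension from boxes is made for one factor at a time, the other
    factor playing the part of the fixed event. Two boxes over disjoint lists
    of indices make up one box over the concatenated list. *)
Lemma subfamily_indep m m' (e : m.-tuple 'I_n) (e' : m'.-tuple 'I_n) :
    uniq (e ++ e') ->
  forall C C', measurable C -> measurable C' ->
    P (subfamily e @^-1` C `&` subfamily e' @^-1` C') =
    P (subfamily e @^-1` C) * P (subfamily e' @^-1` C').
Proof.
move=> uee' C C' mC mC'.
have /and3P[ue _ ue'] : [&& uniq e, ~~ has (mem e) e' & uniq e'].
  by rewrite -cat_uniq.
have mU r (f : r.-tuple 'I_n) D :
    measurable D -> measurable (subfamily f @^-1` D).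
  by move=> mD; rewrite -[X in measurable X]setTI; exact: measurable_subfamily.
apply: subfamily_indep_event => // [|A mA]; first exact: mU.
rewrite setIC muleC; apply: subfamily_indep_event => // [|A' mA'].
  by apply: mU; exact: measurable_box.
pose AA (i : 'I_(m + m')) :=
  match fintype.split i with inl a => A a | inr a => A' a end.
have mAA i : measurable (AA i) by rewrite /AA; case: fintype.split.
have AAl a : AA (lshift m' a) = A a by rewrite /AA (unsplitK (inl a)).
have AAr a : AA (rshift m a) = A' a by rewrite /AA (unsplitK (inr a)).
have := @subfamily_box _ [tuple of e ++ e'] AA uee' mAA.
rewrite big_split_ord/=.
under eq_bigr do rewrite tnth_lshift AAl.
under [X in _ = _ * X -> _]eq_bigr do rewrite tnth_rshift AAr.
rewrite -subfamily_box// -subfamily_box// muleC => <-.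
congr (P _); apply/seteqP; split=> w /=.
  move=> [h' h] i; rewrite tnth_mktuple -(splitK i).
  case: fintype.split => a /=; rewrite ?tnth_lshift ?tnth_rshift ?AAl ?AAr.
    by have := h a; rewrite tnth_mktuple.
  by have := h' a; rewrite tnth_mktuple.
move=> h; split=> a; rewrite tnth_mktuple.
  by have := h (rshift m a); rewrite tnth_mktuple tnth_rshift AAr.
by have := h (lshift m' a); rewrite tnth_mktuple tnth_lshift AAl.
Qed.

End independent_coordinates.

Section independent_functions.
Context {disp disp' : measure_display} {T : measurableType disp}
  {T' : measurableType disp'} {R : realType} (P : probability T R) (n : nat).
Variable xi : 'I_n -> {RV P >-> T'}.
Hypothesis xi_indep : mutually_independent xi.
Local Open Scope ereal_scope.
Local Notation subfamily := (subfamily xi).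

(** The joint law of the two subfamilies is the product of their laws, so
    this is Tonelli's theorem. *)
Lemma integral_subfamily_indep m m' (e : m.-tuple 'I_n) (e' : m'.-tuple 'I_n)
    (G : m.-tuple T' -> R) (H : m'.-tuple T' -> R) :
    uniq (e ++ e') ->
    measurable_fun setT G -> measurable_fun setT H ->
    (forall x, 0 <= G x)%R -> (forall x, 0 <= H x)%R ->
  \int[P]_w (G (subfamily e w) * H (subfamily e' w))%:E =
  \int[P]_w (G (subfamily e w))%:E * \int[P]_w (H (subfamily e' w))%:E.
Proof.
move=> uee' mG mH G0 H0.
pose Z w := (subfamily e w, subfamily e' w).
have mZ : measurable_fun setT Z.
  by apply/measurable_fun_pair; exact: measurable_subfamily.
pose mu := distribution P (subfamily e).
pose mu' := distribution P (subfamily e').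
pose GH (z : m.-tuple T' * m'.-tuple T') : \bar R := (G z.1 * H z.2)%:E.
have mGH : measurable_fun setT GH.
  by apply/measurable_EFinP/measurable_funM; apply: measurableT_comp.
have GH0 z : 0 <= GH z by rewrite lee_fin mulr_ge0.
transitivity (\int[pushforward P Z]_z GH z).
  by rewrite ge0_integral_pushforward.
transitivity (\int[mu \x mu']_z GH z).
  apply: eq_measure_integral => A mA _; apply/esym.
  apply: (@product_measure_unique _ _ _ _ _ mu mu' (pushforward P Z)) => //.
  by move=> C C' mC mC'; exact: subfamily_indep.
rewrite fubini_tonelli1//.
have mEG : measurable_fun setT (EFin \o G) by exact/measurable_EFinP.
have mEH : measurable_fun setT (EFin \o H) by exact/measurable_EFinP.
rewrite /fubini_F /GH/=.
have -> : \int[P]_w (H (subfamily e' w))%:E = \int[mu']_y (H y)%:E.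
  by rewrite ge0_integral_distribution// => y; rewrite lee_fin.
have -> : \int[P]_w (G (subfamily e w))%:E = \int[mu]_x (G x)%:E.
  by rewrite ge0_integral_distribution// => y; rewrite lee_fin.
under eq_integral => x _.
  under eq_integral do rewrite EFinM.
  rewrite ge0_integralZl//; last 2 first.
    by move=> y _; rewrite lee_fin.
    by rewrite lee_fin.
  over.
rewrite ge0_integralZr//; last 2 first.
  by move=> y _; rewrite lee_fin.
  by apply: integral_ge0 => y _; rewrite lee_fin.
Qed.

(** The blocks are split off one by one. The product over the remaining
    blocks is again a function of one subfamily, indexed by the concatenation
    of these blocks, so that independence of two subfamilies suffices. *)
Lemma integral_prod_blocks (I : eqType) (m : nat) (e : I -> m.-tuple 'I_n)
    (G : I -> m.-tuple T' -> R) (js : seq I) :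
    uniq (flatten [seq val (e j) | j <- js]) ->
    (forall j, measurable_fun setT (G j)) -> (forall j x, 0 <= G j x)%R ->
  \int[P]_w (\prod_(j <- js) G j (subfamily (e j) w))%R%:E =
  \prod_(j <- js) \int[P]_w (G j (subfamily (e j) w))%:E.
Proof.
move=> + mG G0.
(* the product over the blocks of s as a function H of one subfamily E *)
have tailE (s : seq I) : exists m' (E : m'.-tuple 'I_n) (H : m'.-tuple T' -> R),
    [/\ val E = flatten [seq val (e j) | j <- s], measurable_fun setT H,
        (forall x, 0 <= H x)%R &
        forall w, (\prod_(j <- s) G j (subfamily (e j) w))%R = H (subfamily E w)].
  elim: s => [|j s [m' [E [H [EE mH H0 GH]]]]].
    exists 0%N, [tuple], (fun=> 1%R); split=> [//|//|//|w].
    by rewrite big_nil.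
  pose pl (x : (m + m').-tuple T') := [tuple tnth x (lshift m' a) | a < m].
  pose pr (x : (m + m').-tuple T') := [tuple tnth x (rshift m a) | a < m'].
  exists (m + m')%N, [tuple of e j ++ E], (fun x => G j (pl x) * H (pr x))%R.
  split=> /=; first by rewrite EE.
  - apply: measurable_funM; apply: measurableT_comp => //;
      apply/measurable_fun_tnthP => a.
      rewrite (_ : _ \o _ = (fun x => tnth x (lshift m' a))); last first.
        by apply/funext => x /=; rewrite tnth_mktuple.
      exact: measurable_tnth.
    rewrite (_ : _ \o _ = (fun x => tnth x (rshift m a))); last first.
      by apply/funext => x /=; rewrite tnth_mktuple.
    exact: measurable_tnth.
  - by move=> x; rewrite mulr_ge0.
  - move=> w; rewrite big_cons GH; congr (G j _ * H _)%R.
      by apply: eq_from_tnth => a; rewrite !tnth_mktuple tnth_lshift.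
    by apply: eq_from_tnth => a; rewrite !tnth_mktuple tnth_rshift.
elim: js => [_|j js IH].
  under eq_integral do rewrite big_nil.
  by rewrite big_nil integral_cst//= probability_setT mul1e.
rewrite /= => ujs; have [m' [E [H [EE mH H0 GH]]]] := tailE js.
rewrite big_cons -IH; last by move: ujs; rewrite cat_uniq => /and3P[].
transitivity (\int[P]_w (G j (subfamily (e j) w) * H (subfamily E w))%:E).
  by apply: eq_integral => w _; rewrite big_cons; congr (_ * _)%:E; exact: GH.
rewrite integral_subfamily_indep ?EE//; congr (_ * _).
by apply: eq_integral => w _; congr EFin; exact/esym/GH.
Qed.

End independent_functions.

(** * Convex functions and Bernoulli weights *)

Section convexity.
Context {R : realType}.

Lemma convex_functionP (f : R -> R) :
  convex_function [set: R^o] (f : R^o -> R^o) <->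
  (forall a x y, 0 <= a <= 1 ->
    f (a * x + (1 - a) * y) <= a * f x + (1 - a) * f y).
Proof.
split=> [cf a x y /andP[a0 a1]|cf t x y _ _]; last first.
  by apply: cf; rewrite ge0 le1.
exact: (cf (Itv01 a0 a1) x y (in_setT x) (in_setT y)).
Qed.

Lemma convex_jensen (f : R -> R) (I : finType) (w x : I -> R) :
    convex_function [set: R^o] (f : R^o -> R^o) ->
    (forall i, 0 <= w i) -> \sum_i w i = 1 ->
  f (\sum_i w i * x i) <= \sum_i w i * f (x i).
Proof.
move=> /convex_functionP cf w0.
(* The mass c at the point y stands for the terms already merged, so that the
   weights sum to 1 at every stage of the induction. *)
suff H (s : seq I) c y : 0 <= c -> c + \sum_(i <- s) w i = 1 ->
    f (c * y + \sum_(i <- s) w i * x i) <=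
    c * f y + \sum_(i <- s) w i * f (x i).
  move=> w1; have := H (index_enum I) 0 0 (lexx _).
  by rewrite !mul0r !add0r w1; apply.
elim: s c y => [c y _|i s IH c y c0].
  by rewrite !big_nil !addr0 => ->; rewrite !mul1r.
rewrite !big_cons !addrA => cs.
have [ci0|] := eqVneq (c + w i) 0.
  have /andP[/eqP -> /eqP wi0] : (c == 0) && (w i == 0).
    by rewrite -paddr_eq0 // ci0.
  move: cs; rewrite ci0 wi0 => cs.
  by have := IH 0 y (lexx _) cs; rewrite !mul0r !addr0.
move=> cwi; have cwi0 : 0 < c + w i by rewrite lt_neqAle eq_sym cwi addr_ge0.
have := IH (c + w i) ((c * y + w i * x i) / (c + w i)) (ltW cwi0) cs.
rewrite mulrC divfK// => /le_trans; apply; rewrite lerD2r.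
have := cf (c / (c + w i)) y (x i).
have -> : 1 - c / (c + w i) = w i / (c + w i) by field.
rewrite divr_ge0 ?(ltW cwi0)// ler_pdivrMr// mul1r lerDl w0 => /(_ isT).
rewrite -(ler_pM2l cwi0).
rewrite (_ : c / _ * y + _ = (c * y + w i * x i) / (c + w i)); last by field.
move=> /le_trans; apply; rewrite le_eqVlt; apply/orP; left; apply/eqP.
by field.
Qed.

(** The probability of the outcome b of k independent trials with success
    probabilities x j. As functions of x these are the multilinear polynomials
    that interpolate at the vertices of the cube. *)
Definition bernoulli_weight (k : nat) (x : 'I_k -> R) (b : {ffun 'I_k -> bool}) :=
  \prod_(j < k) (if b j then x j else 1 - x j).

Lemma bernoulli_weight_ge0 k (x : 'I_k -> R) b :
  (forall j, 0 <= x j <= 1) -> 0 <= bernoulli_weight x b.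
Proof.
move=> x01; apply: prodr_ge0 => j _; have /andP[] := x01 j.
by case: ifP; rewrite ?subr_ge0.
Qed.

Lemma sum_bernoulli_weight k (x : 'I_k -> R) : \sum_b bernoulli_weight x b = 1.
Proof.
rewrite /bernoulli_weight.
rewrite -(bigA_distr_bigA (fun j (c : bool) => if c then x j else 1 - x j)).
by apply: big1 => j _; rewrite big_bool/= addrC subrK.
Qed.

(** The expected number of successes. Each trial j is handled by changing the
    j-th factor of the product, so that the sum over b factorizes again. *)
Lemma mean_bernoulli_weight k (x : 'I_k -> R) :
  \sum_b bernoulli_weight x b * (\sum_(j < k) b j)%:R = \sum_(j < k) x j.
Proof.
transitivity (\sum_(j < k) \sum_b bernoulli_weight x b * (b j)%:R).
  rewrite exchange_big; apply: eq_bigr => b _.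
  by rewrite natr_sum mulr_sumr.
apply: eq_bigr => j _.
pose g i (c : bool) := (if c then x i else 1 - x i) * (if i == j then c%:R else 1).
transitivity (\sum_(b : {ffun 'I_k -> bool}) \prod_i g i (b i)).
  apply: eq_bigr => b _; rewrite big_split/=; congr (_ * _).
  by rewrite -big_mkcond big_pred1_eq.
rewrite -bigA_distr_bigA (bigD1 j)//= big_bool /g eqxx/= mulr1 mulr0 addr0.
rewrite big1 ?mulr1// => i /negPf ij.
by rewrite big_bool/= ij !mulr1 addrC subrK.
Qed.

(** Jensen's inequality for the number of successes: a convex function of the
    sum lies below its multilinear interpolation on the cube. *)
Lemma convex_bernoulli_weight (f : R -> R) k (x : 'I_k -> R) (N : R) :
    convex_function [set: R^o] (f : R^o -> R^o) ->
    (forall j, 0 <= x j <= 1) ->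
  f (N * \sum_(j < k) x j) <=
  \sum_b bernoulli_weight x b * f (N * (\sum_(j < k) b j)%:R).
Proof.
move=> cf x01; rewrite -mean_bernoulli_weight mulr_sumr.
under eq_bigr do rewrite mulrCA.
apply: convex_jensen => //; last exact: sum_bernoulli_weight.
by move=> b; exact: bernoulli_weight_ge0.
Qed.

(** With equal success probabilities the number of successes is binomial. *)
Lemma sum_bernoulli_weight_cst k (p : R) (g : nat -> R) :
  \sum_(b : {ffun 'I_k -> bool}) bernoulli_weight (fun=> p) b * g (\sum_(j < k) b j)%N =
  \sum_(j < k.+1) binomial_pmf k p j * g j.
Proof.
have cardb (b : {ffun 'I_k -> bool}) :
    (\sum_(j < k) b j)%N = #|[set j | b j]%SET|.
  by rewrite -sum1dep_card [RHS]big_mkcond/=; apply: eq_bigr => j _; case: (b j).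
have wE (b : {ffun 'I_k -> bool}) : bernoulli_weight (fun=> p) b =
    p ^+ #|[set j | b j]%SET| * (1 - p) ^+ (k - #|[set j | b j]%SET|).
  rewrite /bernoulli_weight (bigID (fun j => b j))/=; congr (_ * _).
    under eq_bigr => j -> do [].
    by rewrite prodr_const; congr (_ ^+ _); apply: eq_card => j; rewrite !inE.
  under eq_bigr => j /negPf -> do [].
  rewrite prodr_const; congr (_ ^+ _).
  apply/eqP; rewrite -(eqn_add2l #|[set j | b j]%SET|) subnKC; last first.
    by rewrite -[X in (_ <= X)%N]card_ord max_card.
  apply/eqP/(etrans _ (etrans (cardsC [set j | b j]%SET) (card_ord k))).
  by congr (_ + _)%N; apply: eq_card => j; rewrite !inE.
have bk (b : {ffun 'I_k -> bool}) : (#|[set j | b j]%SET| < k.+1)%N.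
  by rewrite ltnS -[X in (_ <= X)%N]card_ord max_card.
rewrite (partition_big (fun b : {ffun 'I_k -> bool} => Ordinal (bk b)) xpredT)//=.
apply: eq_bigr => j _.
transitivity (\sum_(b : {ffun 'I_k -> bool} | #|[set i | b i]%SET| == j)
    p ^+ j * (1 - p) ^+ (k - j) * g j).
  apply: eq_big => b; first by rewrite -val_eqE.
  by move=> /eqP <-/=; rewrite wE cardb.
rewrite sumr_const /binomial_pmf [RHS]mulrnAl; congr (_ *+ _).
pose setb (b : {ffun 'I_k -> bool}) := [set i | b i]%SET.
have setb_bij : bijective setb.
  exists (fun A : {set 'I_k} => [ffun i => i \in A]) => [b|A].
    by apply/ffunP => i; rewrite ffunE inE.
  by apply/setP => i; rewrite inE ffunE.
rewrite -[X in 'C(X, _)]card_ord -card_draws.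
rewrite -(on_card_preimset (onW_bij _ setb_bij)).
by apply: eq_card => b; rewrite !inE.
Qed.

End convexity.

(** * Averages over permutations *)

Section permutation_average.
Context {R : numFieldType}.

(** Sets of the same size are exchanged by a permutation: list each set
    followed by its complement and match the two lists. *)
Lemma perm_imset (T : finType) (A B : {set T}) :
  #|A| = #|B| -> exists r : {perm T}, [set r x | x in B]%SET = A.
Proof.
move=> AB.
have AB' : #|~: A| = #|~: B| by rewrite [LHS]cardsCs [RHS]cardsCs !finset.setCK AB.
have sA : size (enum A ++ enum (~: A)) = #|T|.
  by rewrite size_cat -!cardE cardsC.
have sB : size (enum B ++ enum (~: B)) = #|T|.
  by rewrite size_cat -!cardE cardsC.
have uC (C : {set T}) : uniq (enum C ++ enum (~: C)).
  rewrite cat_uniq !enum_uniq andbT/= -all_predC.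
  by apply/allP => x /=; rewrite mem_enum inE mem_enum.
have inB x : x \in enum B ++ enum (~: B).
  by rewrite mem_cat !mem_enum inE orbN.
pose r x := nth x (enum A ++ enum (~: A)) (index x (enum B ++ enum (~: B))).
have r_inj : injective r.
  move=> x y; rewrite /r (set_nth_default x y) ?sA -?sB ?index_mem// => /eqP.
  rewrite nth_uniq ?uC ?sA -?sB ?index_mem// => /eqP h.
  by rewrite -(nth_index x (inB x)) -[in RHS](nth_index x (inB y)) h.
exists (perm r_inj); apply/eqP; rewrite eqEcard (card_imset _ (@perm_inj _ _)) AB leqnn andbT.
apply/fintype.subsetP => _ /imsetP[x xB ->]; rewrite permE /r !index_cat mem_enum xB.
rewrite nth_cat -[size _]cardE AB cardE index_mem mem_enum xB.
by rewrite -(mem_enum (mem A)) mem_nth// -[X in (_ < X)%N]cardE AB cardE index_mem mem_enum.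
Qed.

(** All the sets of size #|B| are images of B under the same number c of
    permutations, since multiplication by a permutation mapping B to A matches
    those that fix B with those that map B to A. The value of c is found by
    summing the constant function 1. *)
Lemma sum_perm_imset (T : finType) (B : {set T}) (Phi : {set T} -> R) :
  'C(#|T|, #|B|)%:R * \sum_(s : {perm T}) Phi [set s x | x in B]%SET =
  #|{: {perm T}}|%:R * \sum_(A : {set T} | #|A| == #|B|) Phi A.
Proof.
pose c := #|[set s : {perm T} | [set s x | x in B]%SET == B]%SET|.
have cE (A : {set T}) : #|A| = #|B| ->
    #|[set s : {perm T} | [set s x | x in B]%SET == A]%SET| = c.
  move=> /perm_imset[r rA].
  rewrite /c -[RHS](card_imset _ (mulIg r)); apply: eq_card => s.
  rewrite inE; apply/eqP/imsetP => [sA|[s' + ->]].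
    exists (s * r^-1)%g; last by rewrite mulgKV.
    rewrite inE; apply/eqP/setP => x; apply/imsetP/idP => [[z zB ->]|xB].
      rewrite permM; have : s z \in A by rewrite -sA; apply/imsetP; exists z.
      by rewrite -rA => /imsetP[u uB ->]; rewrite permK.
    have : r x \in A by rewrite -rA; apply/imsetP; exists x.
    by rewrite -sA => /imsetP[u uB ru]; exists u => //; rewrite permM -ru permK.
  rewrite inE => /eqP s'B; rewrite -rA; apply/setP => x.
  apply/imsetP/imsetP => -[z zB ->].
    by exists (s' z); rewrite ?permM// -s'B; apply/imsetP; exists z.
  move: zB; rewrite -{1}s'B => /imsetP[u uB ->].
  by exists u => //; rewrite permM.
have sumE (Psi : {set T} -> R) : \sum_(s : {perm T}) Psi [set s x | x in B]%SET =
    c%:R * \sum_(A : {set T} | #|A| == #|B|) Psi A.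
  rewrite (partition_big (fun s : {perm T} => [set s x | x in B]%SET)
    (fun A => #|A| == #|B|))/=; last first.
    by move=> s _; rewrite card_imset//; exact: perm_inj.
  rewrite mulr_sumr; apply: eq_bigr => A /eqP AB.
  rewrite (eq_bigr (fun=> Psi A)); last by move=> s /eqP ->.
  by rewrite sumr_const -(cE A AB) mulr_natl; congr (_ *+ _); apply: eq_card => s; rewrite !inE.
rewrite sumE.
have -> : #|{: {perm T}}|%:R = c%:R * 'C(#|T|, #|B|)%:R :> R.
  have := sumE (fun=> 1); rewrite sumr_const => ->; congr (_ * _).
  by rewrite sumr_const; congr (_ *+ _); rewrite -card_draws; apply: eq_card => A; rewrite !inE.
by rewrite mulrA [c%:R * _]mulrC.
Qed.

End permutation_average.

Section increasing_tuples.
Variables (n d : nat) (i0 : d.-tuple 'I_n).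

(** The value i0 is taken only when A does not have size d. *)
Definition tuple_of_set (A : {set 'I_n}) : d.-tuple 'I_n := insubd i0 (enum A).

Lemma val_tuple_of_set (A : {set 'I_n}) :
  #|A| = d -> val (tuple_of_set A) = enum A.
Proof. by move=> Ad; rewrite val_insubd -cardE Ad eqxx. Qed.

Lemma strictly_increasing_tuple_of_set (A : {set 'I_n}) :
  #|A| = d -> strictly_increasing (tuple_of_set A).
Proof.
move=> Ad; rewrite /strictly_increasing val_tuple_of_set//.
rewrite -[enum _](eq_filter (mem_enum _)).
rewrite -(eq_filter (mem_map val_inj _)) -filter_map.
by rewrite (sorted_filter ltn_trans) // unlock val_ord_enum iota_ltn_sorted.
Qed.

Lemma strictly_increasing_uniq (i : d.-tuple 'I_n) :
  strictly_increasing i -> uniq i.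
Proof.
by move=> /(sorted_uniq ltn_trans ltnn); rewrite (map_inj_uniq val_inj).
Qed.

Lemma sum_strictly_increasing (V : nmodType) (Psi : d.-tuple 'I_n -> V) :
  \sum_(i | strictly_increasing i) Psi i =
  \sum_(A : {set 'I_n} | #|A| == d) Psi (tuple_of_set A).
Proof.
pose set_of (i : d.-tuple 'I_n) : {set 'I_n} := [set j in i]%SET.
rewrite (reindex_onto tuple_of_set set_of)/=; last first.
  move=> i ii; have cd : #|set_of i| = d.
    by rewrite cardsE (card_uniqP _) ?size_tuple// strictly_increasing_uniq.
  apply/val_inj; apply: (inj_map val_inj).
  apply: (irr_sorted_eq ltn_trans ltnn) => //.
    exact: strictly_increasing_tuple_of_set.
  move=> y; rewrite val_tuple_of_set//.
  by apply/mapP/mapP => -[x + ->] => xi; exists x; rewrite // mem_enum inE in xi *.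
apply: eq_bigl => A; apply/andP/eqP => [[incA /eqP <-]|Ad].
  by rewrite cardsE (card_uniqP _) ?size_tuple// strictly_increasing_uniq.
split; first exact: strictly_increasing_tuple_of_set.
by apply/eqP/setP => x; rewrite inE memtE val_tuple_of_set// mem_enum.
Qed.

End increasing_tuples.

Lemma uniq_flatten_map (I T : eqType) (f : I -> seq T) (s : seq I) :
    uniq s -> (forall i, uniq (f i)) ->
    (forall i j x, x \in f i -> x \in f j -> i = j) ->
  uniq (flatten [seq f i | i <- s]).
Proof.
move=> + uf ij; elim: s => //= i s IH /andP[si us].
rewrite cat_uniq uf IH// andbT; apply/hasPn => x /flatten_mapP[j js xj].
by apply: contra si => xi; rewrite (ij _ _ _ xi xj).
Qed.

(** * The binomial comparison *)

Section binomial_expectation.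
Context {d : measure_display} {T : measurableType d} {R : realType}
  (P : probability T R) (B : {RV P >-> nat}) (k : nat) (p : R).
Hypothesis p01 : 0 <= p <= 1.
Hypothesis B_binomial : distribution P B = binomial_prob k p.

Lemma expectation_binomial (g : nat -> R) : (forall j, 0 <= g j) ->
  ('E_P[fun w => g (B w)] = (\sum_(j < k.+1) binomial_pmf k p j * g j)%:E)%E.
Proof.
move=> g0; have /andP[p0 p1] := p01.
have mg : measurable_fun [set: nat] (EFin \o g) by [].
rewrite unlock.
transitivity (\int[distribution P B]_j (g j)%:E)%E.
  by rewrite ge0_integral_distribution// => j; rewrite lee_fin.
rewrite B_binomial (@integral_binomial _ k p p0 p1 (fun j => (g j)%:E)); last first.
  by move=> j; rewrite lee_fin.
by rewrite -sumEFin; apply: eq_bigr => j _; rewrite EFinM.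
Qed.

Lemma probability_binomial (j : nat) :
  (P [set w | B w = j] = (binomial_pmf k p j)%:E)%E.
Proof.
have -> : P [set w | B w = j] = distribution P B [set j] by [].
rewrite B_binomial /binomial_prob p01.
by rewrite esum_set1// lee_fin binomial_pmf_ge0.
Qed.

End binomial_expectation.

Lemma ge0_integral_lincomb {d : measure_display} {T : measurableType d}
    {R : realType} (mu : {measure set T -> \bar R}) (I : finType)
    (c : I -> R) (g : I -> T -> R)
    (v : I -> R) :
    (forall i, 0 <= c i) -> (forall i w, 0 <= g i w) ->
    (forall i, measurable_fun setT (g i)) ->
    (forall i, \int[mu]_w (g i w)%:E = (v i)%:E)%E ->
  (\int[mu]_w (\sum_i c i * g i w)%:E = (\sum_i c i * v i)%:E)%E.
Proof.
move=> c0 g0 mg gv.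
under eq_integral do rewrite -sumEFin.
rewrite ge0_integral_sum//; last 2 first.
  by move=> i; apply/measurable_EFinP/measurable_funM => //; exact: measurable_cst.
  by move=> i w _; rewrite lee_fin mulr_ge0.
rewrite -sumEFin; apply: eq_bigr => i _.
under eq_integral do rewrite EFinM.
rewrite ge0_integralZl//; last 3 first.
  exact/measurable_EFinP.
  by move=> w _; rewrite lee_fin.
  by rewrite lee_fin.
by rewrite gv EFinM.
Qed.

Section averaging.
Context {disp disp' : measure_display} {T : measurableType disp}
  {T' : measurableType disp'} {R : realType} (P : probability T R) (k d : nat).
Variables (xi : 'I_(k * d) -> {RV P >-> T'}) (F : d.-tuple T' -> R).
Hypotheses (d_gt0 : (0 < d)%N) (k_gt0 : (0 < k)%N).
Hypothesis xi_indep : mutually_independent xi.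
Hypothesis xi_ident : identically_distributed xi.
Hypothesis F_meas : measurable_fun [set: d.-tuple T'] F.
Hypothesis F_01 : forall x : d.-tuple T', 0 <= F x <= 1.
Variables (i0 : d.-tuple 'I_(k * d)) (p : R).
Hypothesis i0_incr : strictly_increasing i0.
Hypothesis p_def : (\int[P]_w (F (subfamily xi i0 w))%:E = p%:E)%E.

Let N := 'C((k * d).-1, d.-1).

Lemma binomial_blocks : 'C(k * d, d) = (k * N)%N.
Proof.
apply/eqP; rewrite -(eqn_pmul2l d_gt0).
have := mul_bin_diag (k * d) d.-1; rewrite prednK// => <-.
by rewrite -/N mulnA (mulnC d).
Qed.

Definition block (j : 'I_k) : {set 'I_(k * d)} := [set i : 'I_(k * d) | (i %/ d)%N == j]%SET.

Lemma card_block j : #|block j| = d.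
Proof.
have lt_block (a : 'I_d) : (j * d + a < k * d)%N.
  by rewrite (@leq_trans (j.+1 * d))// ?leq_mul2r ?ltn_ord ?orbT// mulSn addnC ltn_add2r.
rewrite -[RHS]card_ord -(card_imset _ (f := fun a => Ordinal (lt_block a))); last first.
  by move=> a b [] /addnI /val_inj.
apply: eq_card => i; rewrite inE; apply/eqP/imsetP => [ij|[a _ ->]/=]; last first.
  by rewrite divnMDl// divn_small// addn0.
exists (Ordinal (ltn_pmod i d_gt0)) => //; apply/val_inj => /=.
by rewrite -ij -divn_eq.
Qed.

Definition block_tuple (s : {perm 'I_(k * d)}) (j : 'I_k) : d.-tuple 'I_(k * d) :=
  tuple_of_set i0 [set s i | i in block j]%SET.

Lemma card_perm_block (s : {perm 'I_(k * d)}) j : #|[set s i | i in block j]%SET| = d.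
Proof. by rewrite card_imset ?card_block//; exact: perm_inj. Qed.

Lemma uniq_block_tuples s :
  uniq (flatten [seq val (block_tuple s j) | j <- index_enum 'I_k]).
Proof.
apply: uniq_flatten_map => [|j|j j' x]; first exact: index_enum_uniq.
  by rewrite val_tuple_of_set ?enum_uniq// card_perm_block.
rewrite !val_tuple_of_set ?card_perm_block// !mem_enum.
move=> /imsetP[i ij ->] /imsetP[i' ij' /perm_inj ii'].
by move: ij ij'; rewrite !inE ii' => /eqP jE /eqP j'E; apply/val_inj; rewrite /= -jE.
Qed.

(** By [subfamily_ident] the law of a subfamily with distinct indices does not
    depend on the indices. *)
Lemma integral_subfamily_mean (e : d.-tuple 'I_(k * d)) : uniq e ->
  (\int[P]_w (F (subfamily xi e w))%:E = p%:E)%E.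
Proof.
move=> ue; rewrite -p_def.
have mF : measurable_fun setT (EFin \o F) by exact/measurable_EFinP.
have F0 x : (0 <= (F x)%:E)%E by have /andP[] := F_01 x; rewrite lee_fin.
rewrite -(ge0_integral_distribution (subfamily xi e) mF)//.
rewrite -(ge0_integral_distribution (subfamily xi i0) mF)//.
apply: eq_measure_integral => A mA _; apply: subfamily_ident => //.
exact: strictly_increasing_uniq.
Qed.

Lemma mean_01 : 0 <= p <= 1.
Proof.
rewrite -!lee_fin -p_def; apply/andP; split.
  by apply: integral_ge0 => w _; rewrite lee_fin; have /andP[] := F_01 (subfamily xi i0 w).
rewrite -(probability_setT P) -[leRHS]mul1e -integral_cst//.
apply: ge0_le_integral => //.
- by move=> w _; rewrite lee_fin; have /andP[] := F_01 (subfamily xi i0 w).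
- by apply/measurable_EFinP; apply: measurableT_comp.
- by move=> w _; rewrite lee_fin; have /andP[] := F_01 (subfamily xi i0 w).
Qed.

Lemma integral_subfamily_onem (e : d.-tuple 'I_(k * d)) : uniq e ->
  (\int[P]_w (1 - F (subfamily xi e w))%:E = (1 - p)%:E)%E.
Proof.
move=> ue; set J := integral _ _ _.
suff : (p%:E + J = 1%:E)%E.
  case: J => [r [] <-|//|//].
  by rewrite addrAC subrr add0r.
rewrite -(integral_subfamily_mean ue) -ge0_integralD//.
- under eq_integral do rewrite -EFinD addrC subrK.
  by rewrite integral_cst//= probability_setT mul1e.
- by move=> w _; rewrite lee_fin; have /andP[] := F_01 (subfamily xi e w).
- by apply/measurable_EFinP; apply: measurableT_comp.
- by move=> w _; rewrite lee_fin subr_ge0; have /andP[] := F_01 (subfamily xi e w).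
- apply/measurable_EFinP/measurable_funB; first exact: measurable_cst.
  exact: measurableT_comp.
Qed.

Lemma uniq_block_tuple s j : uniq (block_tuple s j).
Proof.
apply: strictly_increasing_uniq; apply: strictly_increasing_tuple_of_set.
exact: card_perm_block.
Qed.

Lemma integral_block_weight (s : {perm 'I_(k * d)}) b :
  (\int[P]_w (bernoulli_weight (fun j => F (subfamily xi (block_tuple s j) w)) b)%:E
   = (bernoulli_weight (fun=> p) b)%:E)%E.
Proof.
pose G j (x : d.-tuple T') := if b j then F x else 1 - F x.
rewrite (@integral_prod_blocks _ _ _ _ _ _ _ _ xi_indep _ _ (block_tuple s) G); first last.
- by move=> j x; rewrite /G; have /andP[F0 F1] := F_01 x; case: (b j); rewrite ?subr_ge0.
- move=> j; rewrite /G; case: (b j) => //.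
  by apply: measurable_funB => //; exact: measurable_cst.
- exact: uniq_block_tuples.
rewrite /bernoulli_weight -prodEFin; apply: eq_bigr => j _.
rewrite /G; case: (b j).
  by rewrite integral_subfamily_mean// uniq_block_tuple.
by rewrite integral_subfamily_onem// uniq_block_tuple.
Qed.

(** [sum_perm_imset] for the block j expresses X as an average over s that
    involves the j-th block only; averaging over j as well brings in the whole
    sum over the blocks, with the factor 'C(k * d, d) / k = N. *)
Lemma sum_strictly_increasing_avg w :
  \sum_(i : d.-tuple 'I_(k * d) | strictly_increasing i) F (subfamily xi i w) =
  \sum_(s : {perm 'I_(k * d)}) #|{: {perm 'I_(k * d)}}|%:R^-1 *
    (N%:R * \sum_(j < k) F (subfamily xi (block_tuple s j) w)).
Proof.
rewrite (sum_strictly_increasing i0).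
set M := #|{: {perm 'I_(k * d)}}|; set X := \sum_(A | _) _.
have M0 : M%:R != 0 :> R.
  by rewrite pnatr_eq0 -lt0n; apply/card_gt0P; exists 1%g.
have k0 : k%:R != 0 :> R by rewrite pnatr_eq0 -lt0n.
have XE (j : 'I_k) :
    k%:R * N%:R * \sum_s F (subfamily xi (block_tuple s j) w) = M%:R * X.
  have := @sum_perm_imset R _ (block j) (fun A => F (subfamily xi (tuple_of_set i0 A) w)).
  by rewrite card_block card_ord binomial_blocks natrM.
rewrite -mulr_sumr -mulr_sumr exchange_big/=.
apply: (mulfI M0); rewrite mulVKf//.
apply: (mulfI k0); rewrite [RHS]mulrA [RHS]mulr_sumr.
rewrite (eq_bigr (fun=> M%:R * X)); last by move=> j _; exact: XE.
by rewrite sumr_const card_ord [LHS]mulr_natl.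
Qed.

Variable X : {RV P >-> R}.
Hypothesis X_def : forall w, X w =
  \sum_(i : d.-tuple 'I_(k * d) | strictly_increasing i) F (subfamily xi i w).

Lemma measurable_F_subfamily (e : d.-tuple 'I_(k * d)) :
  measurable_fun setT (fun w => F (subfamily xi e w)).
Proof. exact: measurableT_comp. Qed.

Lemma expectation_increasing_sum : ('E_P[X] = (p * 'C(k * d, d)%:R)%:E)%E.
Proof.
rewrite unlock.
pose M := #|{: {perm 'I_(k * d)}}|%:R : R.
have M0 : M != 0.
  by rewrite pnatr_eq0 -lt0n; apply/card_gt0P; exists 1%g.
transitivity (\int[P]_w (\sum_(sj : {perm 'I_(k * d)} * 'I_k)
    (M^-1 * N%:R) * F (subfamily xi (block_tuple sj.1 sj.2) w))%:E)%E.
  apply: eq_integral => w _; rewrite X_def sum_strictly_increasing_avg.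
  congr EFin; rewrite -(pair_bigA _ (fun s j =>
    (M^-1 * N%:R) * F (subfamily xi (block_tuple s j) w)))/=.
  by apply: eq_bigr => s _; rewrite mulr_sumr mulr_sumr;
    apply: eq_bigr => j _; rewrite mulrA.
rewrite (ge0_integral_lincomb (c := fun=> M^-1 * N%:R) (v := fun=> p)).
- rewrite sumr_const card_prod card_ord -[_ *+ (_ * _)]mulr_natr.
  rewrite natrM binomial_blocks natrM -/M.
  by congr EFin; field.
- by move=> _; rewrite mulr_ge0 ?invr_ge0 ?ler0n.
- by move=> sj w; have /andP[] := F_01 (subfamily xi (block_tuple sj.1 sj.2) w).
- by move=> sj; exact: measurable_F_subfamily.
- by move=> sj; apply: integral_subfamily_mean; exact: uniq_block_tuple.
Qed.

(** Where y <= X the constant f y is at most f X, hence at most the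
    combination of Bernoulli weights of the blocks obtained by applying Jensen
    over the permutations s and then over the outcomes b. *)
Lemma convex_tail_bound (f : R -> R) (y : R) : increasing_convex f ->
  ((f y)%:E * P [set w | (y <= X w)%R]
   <= (\sum_(j < k.+1) binomial_pmf k p j * f (N%:R * j%:R))%:E)%E.
Proof.
move=> [f0 ndf cf].
have mA : measurable [set w | y <= X w].
  have -> : [set w | y <= X w] = X @^-1` `[y, +oo[%classic.
    by apply/seteqP; split => w /=; rewrite in_itv/= andbT.
  exact: measurable_funPTI.
pose M := #|{: {perm 'I_(k * d)}}|%:R^-1 : R.
have M0 : 0 <= M by rewrite invr_ge0.
have MM : \sum_(s : {perm 'I_(k * d)}) M = 1.
  rewrite sumr_const -mulr_natl; apply: divff.
  by rewrite pnatr_eq0 -lt0n; apply/card_gt0P; exists 1%g.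
pose W (sb : {perm 'I_(k * d)} * {ffun 'I_k -> bool}) w :=
  bernoulli_weight (fun j => F (subfamily xi (block_tuple sb.1 j) w)) sb.2.
pose c (sb : {perm 'I_(k * d)} * {ffun 'I_k -> bool}) :=
  M * f (N%:R * (\sum_(j < k) sb.2 j)%:R).
have c0 sb : 0 <= c sb by rewrite mulr_ge0.
have W0 sb w : 0 <= W sb w by apply: bernoulli_weight_ge0.
have mW sb : measurable_fun setT (W sb).
  apply: measurable_prod => j _.
  case: (sb.2 j); first exact: measurable_F_subfamily.
  apply: measurable_funB; first exact: measurable_cst.
  exact: measurable_F_subfamily.
have fX w : f (X w) <= \sum_sb c sb * W sb w.
  rewrite X_def sum_strictly_increasing_avg.
  apply: (le_trans (convex_jensen (w := fun=> M) _ cf _ MM)) => //.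
  rewrite -(pair_bigA _ (fun s b => c (s, b) * W (s, b) w))/=.
  apply: ler_sum => s _.
  apply: le_trans (ler_wpM2l M0 (convex_bernoulli_weight _ cf _)) _ => //.
  rewrite mulr_sumr le_eqVlt; apply/orP; left; apply/eqP; apply: eq_bigr => b _.
  by rewrite /c /W/= mulrCA mulrC.
have -> : \sum_(j < k.+1) binomial_pmf k p j * f (N%:R * j%:R) =
    \sum_sb c sb * bernoulli_weight (fun=> p) sb.2.
  rewrite -(@sum_bernoulli_weight_cst R k p (fun j => f (N%:R * j%:R))).
  rewrite -(pair_bigA _ (fun s b => c (s, b) * bernoulli_weight (fun=> p) b))/=.
  rewrite -[LHS]mul1r -[X in X * _]MM mulr_suml; apply: eq_bigr => s _.
  rewrite mulr_sumr; apply: eq_bigr => b _.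
  by rewrite /c/= mulrA mulrAC.
rewrite -(ge0_integral_lincomb (mu := P) c0 W0 mW
  (v := fun sb => bernoulli_weight (fun=> p) sb.2)); last first.
  by move=> [s b]; exact: integral_block_weight.
rewrite -(setIT [set w | _]) -integral_indic// -ge0_integralZl//; last 2 first.
- by apply/measurable_EFinP; exact: measurable_indic.
- by rewrite lee_fin.
apply: ge0_le_integral => //.
- by move=> w _; rewrite -EFinM lee_fin mulr_ge0.
- apply/measurable_EFinP/measurable_funM; first exact: measurable_cst.
  exact: measurable_indic.
- apply/measurable_EFinP/measurable_sum => sb.
  by apply: measurable_funM => //; exact: measurable_cst.
- move=> w _; rewrite -EFinM lee_fin indicE; have [yX|Xy] := leP y (X w).
    by rewrite mem_set//= mulr1 (le_trans (ndf _ _ yX)).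
  rewrite memNset/= ?mulr0; last by apply/negP; rewrite -ltNge.
  by apply: sumr_ge0 => sb _; rewrite mulr_ge0.
Qed.

End averaging.

(** * Exponential moments of the binomial law *)

Section exponential_moments.
Context {R : realType}.
Implicit Types (p a t x l : R).

Lemma bernoulli_mgf_gt0 p l : 0 <= p -> p < 1 -> 0 < 1 - p + p * expR l.
Proof. by move=> p0 p1; rewrite ltr_pwDl ?subr_gt0// mulr_ge0// expR_ge0. Qed.

(** The difference phi of the logarithms vanishes at 0 together with its
    derivative psi, and its second derivative is 1/4 - w (1 - w) >= 0, where w
    is the success probability tilted by the exponent. *)
Lemma hoeffding_lemma p l : 0 <= p -> p < 1 -> 0 <= l ->
  1 - p + p * expR l <= expR (p * l + l ^+ 2 / 8).
Proof.
move=> p0 p1 l0.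
pose D x := 1 - p + p * expR x.
have D0 x : 0 < D x by exact: bernoulli_mgf_gt0.
pose w x := p * expR x / D x.
have D'E x : is_derive x 1 D (p * expR x).
  by rewrite /D; apply: is_derive_eq; rewrite /GRing.scale/= !(mul1r,mulr1,mulr0,add0r,addr0).
have w'E x : is_derive x 1 w (w x * (1 - w x)).
  have Dx0 : D x != 0 by rewrite gt_eqF.
  have V := is_deriveV Dx0 (D'E x).
  rewrite /w; apply: is_derive_eq.
  by rewrite /GRing.scale/=; field.
pose psi x := p + x / 4 - w x.
have psi'E x : is_derive x 1 psi (4^-1 - w x * (1 - w x)).
  rewrite /psi; apply: is_derive_eq.
  by rewrite /GRing.scale/= mulr0 mulr0 add0r add0r mul1r mulr1.
pose phi x := p * x + x ^+ 2 / 8 - ln (D x).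
have phi'E x : is_derive x 1 phi (psi x).
  have lnD : is_derive x 1 (@ln R \o D) ((D x)^-1 * (p * expR x)).
    exact: is_derive1_comp (is_derive1_ln (D0 x)) (D'E x).
  rewrite /phi; apply: is_derive_eq.
  have Dx0 : D x != 0 by rewrite gt_eqF.
  by rewrite /GRing.scale/= /psi /w; field.
have psi0 x : 0 <= x -> 0 <= psi x.
  move=> x0.
  have <- : psi 0 = 0 by rewrite /psi /w /D expR0; field; lra.
  apply: (ger0_derive1_ndecry (a := 0)) => //.
  - move=> z _; rewrite derive1E derive_val.
    by have := sqr_ge0 (w z - 2^-1); rewrite expr2; lra.
  - apply: continuous_subspaceT => z.
    by apply/differentiable_continuous/derivable1_diffP; have [] := psi'E z.
have : 0 <= phi l.
  have <- : phi 0 = 0 by rewrite /phi /D expR0 mulr1 subrK ln1; lra.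
  apply: (ger0_derive1_ndecry (a := 0)) => //.
  - move=> z; rewrite in_itv/= andbT => z0; rewrite derive1E derive_val.
    by apply: psi0; exact: ltW.
  - apply: continuous_subspaceT => z.
    by apply/differentiable_continuous/derivable1_diffP; have [] := phi'E z.
by rewrite /phi subr_ge0 -ler_expR lnK ?posrE.
Qed.

(** Strict convexity of exp between 0 and x. After division by exp (a x) it is
    the weighted sum of 1 + z < exp z at z = - a x and z = (1 - a) x. *)
Lemma expR_convex_lt a x : 0 < a < 1 -> x != 0 ->
  expR (a * x) < 1 - a + a * expR x.
Proof.
move=> /andP[a0 a1] x0.
have e0 : 0 < expR (a * x) by exact: expR_gt0.
have h1 : 1 + - (a * x) < expR (- (a * x)).
  by apply: expR_gt1Dx; rewrite oppr_eq0 mulf_neq0// gt_eqF.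
have h2 : 1 + (1 - a) * x < expR ((1 - a) * x).
  by apply: expR_gt1Dx; rewrite mulf_neq0// gt_eqF// subr_gt0.
have -> : 1 - a + a * expR x =
    expR (a * x) * ((1 - a) * expR (- (a * x)) + a * expR ((1 - a) * x)).
  rewrite mulrDr !mulrA ![expR (a * x) * _]mulrC -!mulrA -!expRD subrr expR0 mulr1.
  by rewrite -mulrDl (addrC a) subrK mul1r.
rewrite -[ltLHS]mulr1 ltr_pM2l//.
nra.
Qed.

(** Otherwise moving x to ln q, where q = a (1 - p) / (p (1 - a)) > e, would
    decrease the function strictly: at ln q the tilted success probability is
    a, and relative to this value the function is compared by strict convexity
    of exp. If p = 0 the function decreases and has no minimizer. *)
Lemma minimizer_gt1 (k m : nat) p a x : (0 < k)%N ->
    0 <= p -> p < a < 1 -> k%:R * a = m%:R -> 0 < x ->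
    p * (1 - a) * expR 1 < a * (1 - p) ->
    (forall x', 0 < x' ->
      expR (- (x * m%:R)) * (1 - p + p * expR x) ^+ k <=
      expR (- (x' * m%:R)) * (1 - p + p * expR x') ^+ k) ->
  1 < x.
Proof.
move=> k0 p0 /andP[pa a1] kam x0 cond minx.
have a0 : 0 < a by lra.
have p1 : p < 1 by lra.
have k0' : 0 < k%:R :> R by rewrite ltr0n.
have m0 : 0 < m%:R :> R by rewrite -kam mulr_gt0.
have pgt0 : 0 < p.
  rewrite lt_neqAle p0 andbT; apply/eqP => p_eq0.
  have := minx (x + 1); rewrite -p_eq0 !mul0r subr0 !addr0 expr1n !mulr1 ler_expR.
  by move=> /(_ ltac:(lra)); nra.
rewrite ltNge; apply/negP => x1.
pose q := a * (1 - p) / (p * (1 - a)).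
have q0 : 0 < q by rewrite divr_gt0// mulr_gt0// subr_gt0.
have eq : expR 1 < q.
  by rewrite /q ltr_pdivlMr ?mulr_gt0 ?subr_gt0// mulrC.
have lnq : 1 < ln q by rewrite -ltr_expR lnK ?posrE.
have := minx (ln q) (lt_trans ltr01 lnq); apply/negP; rewrite -ltNge lnK ?posrE//.
have qE : 1 - p + p * q = (1 - p) / (1 - a) by rewrite /q; field; lra.
(* p * q / (1 - p + p * q) = a, so the two terms have weights 1 - a and a *)
have xE : 1 - p + p * expR x = (1 - p + p * q) * (1 - a + a * expR (x - ln q)).
  rewrite qE expRD expRN lnK ?posrE// /q; field.
  by rewrite !gt_eqF// subr_gt0.
have lt_x : (1 - p + p * q) * expR (a * (x - ln q)) < 1 - p + p * expR x.
  rewrite xE ltr_pM2l; last by rewrite qE divr_gt0 ?subr_gt0.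
  by apply: expR_convex_lt; [lra|rewrite subr_eq0 lt_eqF//; lra].
have E0 : 0 <= (1 - p + p * q) * expR (a * (x - ln q)).
  by rewrite mulr_ge0 ?expR_ge0// qE divr_ge0 ?subr_ge0; lra.
have := ltrXn2r k E0 lt_x.
rewrite gtn_eqF// => lt_k.
rewrite -(ltr_pM2l (expR_gt0 (x * m%:R))) [ltRHS]mulrA -expRD subrr expR0 mul1r.
apply: le_lt_trans lt_k.
rewrite exprMn -expRM_natl [leLHS]mulrA -expRD mulrC le_eqVlt; apply/orP; left; apply/eqP.
by congr (_ * expR _); rewrite -kam; ring.
Qed.

(** Equality holds at i = 1; the general case is 1 + z <= exp z at
    z = x (i - 1). *)
Lemma linear_le_exp x (i : nat) : 0 <= x -> (0 < i)%N ->
  1 + x * i%:R <= (x + 1) / expR x * expR (x * i%:R).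
Proof.
move=> x0 i0.
rewrite -mulrA -expRN -expRD.
have -> : - x + x * i%:R = x * (i%:R - 1) by ring.
have i1 : 1 <= i%:R :> R by rewrite ler1n.
apply: le_trans (ler_wpM2l _ (expR_ge1Dx _)); last by lra.
by nra.
Qed.

Lemma binomial_mgf (k : nat) p x :
  \sum_(j < k.+1) binomial_pmf k p j * expR (x * j%:R) = (1 - p + p * expR x) ^+ k.
Proof.
rewrite exprDn; apply: eq_bigr => j _.
by rewrite /binomial_pmf mulrnAl exprMn -expRM_natr mulrA (mulrC (p ^+ j)).
Qed.

(** The exponent 4 t minimizes l^2 / 8 - l t, which is what Hoeffding's lemma
    leaves of the logarithm for each of the k trials. *)
Lemma chernoff_hoeffding (k : nat) p t : 0 <= p -> p < 1 -> 0 <= t ->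
  expR (- (4 * t * (k%:R * (p + t)))) * (1 - p + p * expR (4 * t)) ^+ k <=
  expR (- (2 * k%:R * t ^+ 2)).
Proof.
move=> p0 p1 t0.
have H : (1 - p + p * expR (4 * t)) ^+ k <= expR (p * (4 * t) + (4 * t) ^+ 2 / 8) ^+ k.
  rewrite lerXn2r ?nnegrE ?expR_ge0 ?hoeffding_lemma ?mulr_ge0//.
  exact/ltW/bernoulli_mgf_gt0.
apply: le_trans (ler_wpM2l (expR_ge0 _) H) _.
rewrite -expRM_natl -expRD ler_expR le_eqVlt; apply/orP; left; apply/eqP.
by field.
Qed.

Definition hinge h y : R -> R := fun z => Num.max 0 (1 + h * (z - y)).

Lemma hinge_increasing_convex h y : 0 <= h -> increasing_convex (hinge h y).
Proof.
move=> h0; split.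
- by move=> z; rewrite /hinge le_max lexx.
- move=> z z' zz'; rewrite /hinge ge_max le_max lexx/= le_max; apply/orP; right.
  by rewrite lerD2l ler_wpM2l// lerD2r.
- apply/convex_functionP => a z z' /andP[a0 a1]; rewrite /hinge ge_max.
  have A : 0 <= Num.max 0 (1 + h * (z - y)) by rewrite le_max lexx.
  have B : 0 <= Num.max 0 (1 + h * (z' - y)) by rewrite le_max lexx.
  have A' : 1 + h * (z - y) <= Num.max 0 (1 + h * (z - y)) by rewrite le_max lexx orbT.
  have B' : 1 + h * (z' - y) <= Num.max 0 (1 + h * (z' - y)) by rewrite le_max lexx orbT.
  apply/andP; split; nra.
Qed.

End exponential_moments.

(** * The refined bound *)

Section refined.
Context {disp : measure_display} {T : measurableType disp} {R : realType}
  (P : probability T R) (B : {RV P >-> nat}) (k m N : nat) (p t h : R).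
Hypotheses (p01 : 0 <= p <= 1) (B_binomial : distribution P B = binomial_prob k p).
Hypotheses (k_gt0 : (0 < k)%N) (m_gt0 : (0 < m)%N) (N_gt0 : (0 < N)%N).
Hypotheses (t0 : 0 < t) (t1 : t < 1 - p) (mE : k%:R * (p + t) = m%:R).
Hypothesis h0 : 0 < h.

Let y : R := m%:R * N%:R.
Let pmf := binomial_pmf k p.
Let x := h * N%:R.

Lemma p_lt1 : p < 1.
Proof. by rewrite -subr_gt0; exact: lt_trans t0 t1. Qed.

Lemma pt_lt1 : p + t < 1.
Proof. by rewrite addrC -ltrBrDr. Qed.

Lemma exponential_boundE s :
  (exponential_bound B N y s =
   (expR (- (s * N%:R * m%:R)) * (1 - p + p * expR (s * N%:R)) ^+ k)%:E)%E.
Proof.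
rewrite /exponential_bound (expectation_binomial p01 B_binomial
  (g := fun j => expR (s * N%:R * j%:R))).
  by rewrite binomial_mgf -EFinM; congr (expR (- _) * _)%:E; rewrite /y; ring.
by move=> j; exact: expR_ge0.
Qed.

Let shifted_moment := \sum_(j < k.+1) pmf j * expR (x * (j%:R - m%:R)).

Lemma shifted_momentE : exponential_bound B N y h = shifted_moment%:E.
Proof.
rewrite exponential_boundE -binomial_mgf mulr_sumr; congr EFin.
apply: eq_bigr => j _; rewrite mulrCA -expRD; congr (_ * expR _).
by rewrite /x; ring.
Qed.

Hypothesis h_min : exponential_bound B N y h =
  ereal_inf [set exponential_bound B N y s | s in [set s : R | 0 < s]].

Lemma h_minimizer s : 0 < s ->
  (exponential_bound B N y h <= exponential_bound B N y s)%E.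
Proof. by move=> s0; rewrite h_min; apply: ereal_inf_lbound; exists s. Qed.

Let E0 := expR (- (2 * k%:R * t ^+ 2)).

Lemma shifted_moment_le : shifted_moment <= E0.
Proof.
have N0 : N%:R != 0 :> R by rewrite pnatr_eq0 -lt0n.
have /andP[p0 _] := p01.
rewrite -lee_fin -shifted_momentE.
apply: (le_trans (h_minimizer (s := 4 * t / N%:R) _)).
  by rewrite divr_gt0 ?ltr0n// mulr_gt0.
rewrite exponential_boundE divfK// -mE lee_fin.
by apply: chernoff_hoeffding => //; [exact: p_lt1|exact: ltW].
Qed.

Hypothesis t_large : p * (1 - p) * (expR 1 - 1) / (1 - p + expR 1 * p) < t.

(** The lower bound on t is the condition a (1 - p) > e p (1 - a) for
    a = p + t, solved for t. *)
Lemma slope_gt1 : 1 < x.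
Proof.
have /andP[p0 _] := p01.
have N0 : 0 < N%:R :> R by rewrite ltr0n.
apply: (@minimizer_gt1 R k m p (p + t)) => //.
- by rewrite ltrDl t0 pt_lt1.
- by rewrite /x mulr_gt0.
- move: t_large; rewrite ltr_pdivrMr; last first.
    by rewrite ltr_pwDl ?mulr_ge0 ?expR_ge0// subr_gt0 p_lt1.
  by lra.
- move=> x' x'0; have := h_minimizer (s := x' / N%:R) (divr_gt0 x'0 N0).
  by rewrite !exponential_boundE lee_fin divfK ?gt_eqF.
Qed.

Let ratio := (x + 1) / expR x.
Let lower_part := \sum_(j < m) expR (x * (j%:R - m%:R)) * pmf j.

Lemma m_lt_k : (m < k)%N.
Proof.
by rewrite -(ltr_nat R) -mE -[ltRHS]mulr1 ltr_pM2l ?ltr0n// pt_lt1.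
Qed.

Lemma T2E : T2 B N h y m = lower_part%:E.
Proof.
rewrite /T2 big_mkord /lower_part -sumEFin; apply: eq_bigr => j _.
rewrite (probability_binomial p01 B_binomial) -EFinM; congr (expR _ * _)%:E.
by rewrite /x /y; ring.
Qed.

Lemma refined_boundE :
  refined_bound B N h y k m t = (ratio * (E0 - lower_part) + (1 - ratio) * pmf m)%:E.
Proof.
by rewrite /refined_bound T2E (probability_binomial p01 B_binomial).
Qed.

Lemma pmf_ge0 j : 0 <= pmf j.
Proof. exact: binomial_pmf_ge0. Qed.

Lemma ratio_01 : 0 < ratio < 1.
Proof.
have x1 := slope_gt1.
rewrite /ratio divr_gt0 ?expR_gt0//=; last by lra.
rewrite ltr_pdivrMr ?expR_gt0// mul1r addrC; apply: expR_gt1Dx.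
by rewrite gt_eqF//; lra.
Qed.

Lemma lower_part_gt0 : 0 < lower_part.
Proof.
rewrite /lower_part (bigD1 (Ordinal m_gt0))//= ltr_pwDl//.
  rewrite mulr_gt0 ?expR_gt0// /pmf /binomial_pmf bin0 expr0 mul1r mulr1n exprn_gt0//.
  by rewrite subr_gt0 p_lt1.
by apply: sumr_ge0 => j _; rewrite mulr_ge0 ?expR_ge0 ?pmf_ge0.
Qed.

Lemma refined_bound_lt : (refined_bound B N h y k m t < E0%:E)%E.
Proof.
have /andP[c0 c1] := ratio_01.
have pm : pmf m <= E0.
  apply: le_trans shifted_moment_le.
  rewrite /shifted_moment (bigD1 (Ordinal (leqW m_lt_k : (m < k.+1)%N)))//=.
  rewrite subrr mulr0 expR0 mulr1 lerDl.
  by apply: sumr_ge0 => j _; rewrite mulr_ge0 ?expR_ge0 ?pmf_ge0.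
rewrite refined_boundE lte_fin.
have := lower_part_gt0; nra.
Qed.

(** Summed over j, the right-hand sides give [refined_bound] with
    E[exp (h (N * B - y))] in place of exp (- 2 k t^2). *)
Lemma hinge_term (j : 'I_k.+1) : pmf j * hinge h y (N%:R * j%:R) <=
  ratio * (pmf j * expR (x * (j%:R - m%:R)) -
       (if (j < m)%N then expR (x * (j%:R - m%:R)) * pmf j else 0)) +
  (if (j : nat) == m then (1 - ratio) * pmf j else 0).
Proof.
have x1 := slope_gt1; have q0 := pmf_ge0 j.
have -> : hinge h y (N%:R * j%:R) = Num.max 0 (1 + x * (j%:R - m%:R)).
  by rewrite /hinge /x /y; congr (Num.max _ (1 + _)); ring.
case: ltngtP => [jm|mj|->].
- rewrite max_l; first by rewrite mulr0 (mulrC (expR _)) subrr mulr0 addr0.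
  have : j%:R + 1 <= m%:R :> R by rewrite natr1 ler_nat.
  by nra.
- rewrite subr0 addr0 mulrCA ler_wpM2l//.
  rewrite -natrB; last exact: ltnW.
  rewrite max_r; last by rewrite addr_ge0// mulr_ge0//; lra.
  by apply: linear_le_exp; [lra|rewrite subn_gt0].
- rewrite subrr mulr0 addr0 expR0 mulr1 subr0 max_r// mulr1.
  by rewrite -mulrDl addrC subrK mul1r.
Qed.

Lemma hinge_bound :
  (increasing_convex_bound B N y <= refined_bound B N h y k m t)%E.
Proof.
have hy : hinge h y y = 1 by rewrite /hinge subrr mulr0 addr0 max_r.
have hic := hinge_increasing_convex y (ltW h0).
have h_ge0 z : 0 <= hinge h y z by have [] := hic.
apply: (@le_trans _ _ ((hinge h y y)^-1%:E *
    'E_P[fun w => hinge h y (N%:R * (B w)%:R)])%E).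
  by apply: ereal_inf_lbound; exists (hinge h y) => //; split => //=; rewrite hy.
rewrite hy invr1 mul1e.
rewrite (expectation_binomial p01 B_binomial (g := fun j => hinge h y (N%:R * j%:R)))//.
rewrite refined_boundE lee_fin.
apply: le_trans (ler_sum _ (fun j _ => hinge_term j)) _.
rewrite big_split/= -mulr_sumr sumrB -/shifted_moment.
have -> : \sum_(j < k.+1)
    (if (j < m)%N then expR (x * (j%:R - m%:R)) * pmf j else 0) = lower_part.
  have mk : (m <= k.+1)%N by rewrite ltnW// ltnW// ltnS m_lt_k.
  rewrite -big_mkcond/= /lower_part.
  by rewrite (big_ord_widen k.+1 (fun j => expR (x * (j%:R - m%:R)) * pmf j) mk).
have -> : \sum_(j < k.+1) (if (j : nat) == m then (1 - ratio) * pmf j else 0) =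
    (1 - ratio) * pmf m.
  have mk : (m < k.+1)%N by rewrite ltnW// ltnS m_lt_k.
  rewrite -big_mkcond/= (big_pred1 (Ordinal mk))//.
rewrite lerD2r ler_wpM2l//; first by have /andP[/ltW] := ratio_01.
by rewrite lerD2r shifted_moment_le.
Qed.

End refined.

(** * Tail bounds for sums over increasing tuples *)

Theorem theorem1p16 (R : realType)
    (disp : measure_display) (T : measurableType disp) (P : probability T R)
    (n d k : nat) (d_gt0 : (0 < d)%N) (k_gt0 : (0 < k)%N) (n_def : n = (k * d)%N)
    (xi : 'I_n -> {RV P >-> R})
    (xi_indep : mutually_independent xi)
    (xi_ident : identically_distributed xi)
    (F : d.-tuple R -> R)
    (F_meas : measurable_fun [set: d.-tuple R] F)
    (F_01 : forall x : d.-tuple R, 0 <= F x <= 1)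
    (X : {RV P >-> R})
    (X_def : forall w : T, X w =
      \sum_(i : d.-tuple 'I_n | strictly_increasing i)
        F [tuple xi (tnth i a) w | a < d])
    (i0 : d.-tuple 'I_n) (i0_incr : strictly_increasing i0)
    (p : R)
    (p_def : p%:E = ('E_P[fun w => F [tuple xi (tnth i0 a) w | a < d]])%E)
    (disp' : measure_display) (T' : measurableType disp') (P' : probability T' R)
    (B : {RV P' >-> nat})
    (B_binomial : distribution P' B = binomial_prob k p)
    (N : nat) (N_def : N = 'C(n.-1, d.-1))
    (t y : R)
    (y_def : y%:E = ('E_P[X] + (t * 'C(n, d)%:R)%:E)%E) :
  (0 < t < 1 - p ->
     (P [set w | (y <= X w)%R] <= increasing_convex_bound B N y)%E) /\
  (p * (1 - p) * (expR 1 - 1) / (1 - p + expR 1 * p) < t < 1 - p ->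
   forall m : nat, k%:R * (p + t) = m%:R -> (0 < m)%N ->
     k%:R * p < m%:R < (k%:R : R) ->
   forall h : R, 0 < h ->
     exponential_bound B N y h =
       ereal_inf [set exponential_bound B N y s | s in [set s : R | 0 < s]] ->
     (increasing_convex_bound B N y <= refined_bound B N h y k m t)%E /\
     (refined_bound B N h y k m t < (expR (- (2 * k%:R * t ^+ 2)))%:E)%E).
Proof.
subst n.
have mean_i0 : (\int[P]_w (F (subfamily xi i0 w))%:E = p%:E)%E.
  by rewrite p_def unlock.
have X_sum w : X w = \sum_(i : d.-tuple 'I_(k * d) | strictly_increasing i)
    F (subfamily xi i w) := X_def w.
have p01 : 0 <= p <= 1 := mean_01 F_meas F_01 mean_i0.
split=> [_|].
  apply: le_ereal_inf_tmp => _ [f [icf fy0] <-].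
  rewrite (expectation_binomial p01 B_binomial (g := fun j => f (N%:R * j%:R))); last first.
    by move=> j; have [f0 _ _] := icf; exact: f0.
  rewrite lee_pdivlMl//.
  by rewrite N_def; apply: (convex_tail_bound d_gt0 k_gt0 xi_indep xi_ident F_meas F_01
    i0_incr mean_i0 X_sum).
move=> /andP[t_large t_lt] m km m_gt0 /andP[m_gt m_lt] h h_gt0 h_min.
have k0 : 0 < k%:R :> R by rewrite ltr0n.
have N_gt0 : (0 < N)%N.
  by rewrite N_def bin_gt0 -ltnS !prednK ?muln_gt0 ?k_gt0 // leq_pmull.
have t0 : 0 < t by move: m_gt; rewrite -km ltr_pM2l// ltrDl.
have yE : y = m%:R * N%:R.
  move: y_def; rewrite (expectation_increasing_sum d_gt0 k_gt0 xi_indep xi_ident F_meas F_01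
    i0_incr mean_i0 X_sum).
  rewrite -EFinD => -[->]; rewrite -mulrDl (binomial_blocks k d_gt0) -N_def natrM -km.
  by ring.
subst y; split.
  exact: (hinge_bound p01 B_binomial k_gt0 N_gt0 t0 t_lt km h_gt0 h_min).
exact: (refined_bound_lt p01 B_binomial k_gt0 m_gt0 N_gt0 t0 t_lt km h_gt0 h_min).
Qed.
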